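(* Let $G$ be a digraph whose underlying graph is a 3-tree. If $g(G) \geq 3$, then $\beta(G) \leq \frac{m(G)-3}{3}$. Moreover, this bound is tight: there exist digraphs $G$ with arbitrarily many vertices whose underlying graph is a 3-tree, with $g(G) \geq 3$, and with $\beta(G) = \frac{m(G)-3}{3}$.
   Context: All graphs and digraphs are finite. A graph is a pair $(V,E)$ with $E$ a set of unordered pairs of distinct vertices. A digraph is a pair $(V,E)$ with $E$ a set of ordered pairs of distinct vertices, called arcs (so there are no loops or parallel arcs, but both $uv$ and $vu$ may be arcs). The underlying graph of a digraph has the same vertex set, and $u,v$ are adjacent in it if and only if at least one of $uv$, $vu$ is an arc. $m(G)$ is the number of arcs of $G$. A dicycle is a directed walk in which all vertices are distinct except that the first and last vertices coincide (directed cycle; length at least 2). $g(G)$ is the length of a shortest dicycle in $G$, with $g(G)=\infty$ if $G$ has no dicycle. A feedback arc set of $G$ is a set of arcs that intersects (the arc set of) every dicycle of $G$, and $\beta(G)$ is the size of a minimum feedback arc set of $G$. A clique is a set of pairwise adjacent vertices. A graph $H$ is a $k$-tree if it has $n \geq k+1$ vertices and there is an ordering $v_1,\ldots,v_n$ of its vertices such that for every $i$, the set $N_{H_i}(v_i)$ of neighbors of $v_i$ in $H_i$ is a clique of size $\min\{k,i-1\}$, where $H_i$ is the subgraph induced by $v_1,\ldots,v_i$. A 3-tree is a $k$-tree with $k=3$. *)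

(* Defs.v *)
From mathcomp Require Import all_boot.

Set Implicit Arguments.
Unset Strict Implicit.
Unset Printing Implicit Defensive.

(* A set of unordered pairs of distinct vertices, given by its adjacency
   relation. *)
Record graph := Graph {
  gvertex :> finType;
  adj : rel gvertex;
  adj_sym : symmetric adj;
  adj_irrefl : irreflexive adj
}.

Record digraph := Digraph {
  dvertex :> finType;
  arcs : {set dvertex * dvertex};
  arcs_irrefl : forall x, (x, x) \notin arcs
}.

Definition arc (G : digraph) : rel G := fun x y => (x, y) \in arcs G.

Definition num_arcs (G : digraph) : nat := #|arcs G|.

Section Underlying.

Variable G : digraph.

Definition uadj : rel G := fun x y => arc x y || arc y x.

Lemma uadj_sym : symmetric uadj.
Proof. by move=> x y; rewrite /uadj orbC. Qed.

Lemma uadj_irrefl : irreflexive uadj.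
Proof. by move=> x; rewrite /uadj /arc orbb (negbTE (arcs_irrefl x)). Qed.

Definition underlying : graph := Graph uadj_sym uadj_irrefl.

End Underlying.

Section KTree.

Variable H : graph.

Definition clique (K : {set H}) : Prop :=
  forall x y, x \in K -> y \in K -> x != y -> adj x y.

(* The neighbors of x in the subgraph of H induced by S, for x in S. *)
Definition nbrs_in (S : {set H}) (x : H) : {set H} := [set y in S | adj x y].

(* Orderings are indexed from 0: [v i] is the (i+1)-st vertex, so the clique
   size min(k, (i+1) - 1) is [minn k i].  An injection from ['I_#|H|] to H is a
   bijection. *)
Definition ktree (k : nat) : Prop :=
  k.+1 <= #|H| /\
  exists2 v : 'I_#|H| -> H, injective v &
    forall i : 'I_#|H|,
      let N := nbrs_in [set v j | j : 'I_#|H| & j <= i] (v i) in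
      clique N /\ #|N| = minn k i.

End KTree.

Section Dicycles.

Variable G : digraph.

(* [c] lists the vertices of the dicycle without repeating the first one at the
   end, so [size c] is its length. *)
Definition dicycle (c : seq G) : bool :=
  [&& 1 < size c, uniq c & cycle (@arc G) c].

Definition dicycle_arcs (c : seq G) : {set G * G} :=
  [set (x, next c x) | x in c].

Lemma dicycle_size c : dicycle c -> size c < #|G|.+1.
Proof.
by case/and3P=> _ /card_uniqP <- _; rewrite ltnS max_card.
Qed.

(* [None] stands for infinity. *)
Definition girth : option nat :=
  ohead [seq k <- iota 0 #|G|.+1 | [exists c : k.-tuple G, dicycle c]].

(* Quantifying over lengths at most #|G| covers all dicycles: see
   [feedback_arc_setP]. *)
Definition feedback_arc_set (F : {set G * G}) : bool :=
  (F \subset arcs G) &&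
  [forall k : 'I_#|G|.+1, forall c : k.-tuple G,
     dicycle c ==> (F :&: dicycle_arcs c != set0)].

Lemma feedback_arc_setP (F : {set G * G}) :
  reflect (F \subset arcs G /\
           forall c : seq G, dicycle c -> F :&: dicycle_arcs c != set0)
          (feedback_arc_set F).
Proof.
apply: (iffP andP) => -[sF hF]; split=> //.
  move=> c dc; have /forallP/(_ (in_tuple c))/implyP :=
    forallP hF (Ordinal (dicycle_size dc)).
  exact.
by apply/forallP=> k; apply/forallP=> c; apply/implyP; apply: hF.
Qed.

Lemma feedback_arc_set_arcs : feedback_arc_set (arcs G).
Proof.
apply/feedback_arc_setP; split=> // c /and3P[sz uc cc].
case: c sz uc cc => // x c _ _ cc; apply/set0Pn; exists (x, next (x :: c) x).
rewrite inE; apply/andP; split; first exact: (next_cycle cc (mem_head x c)).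
by apply/imsetP; exists x; rewrite ?mem_head.
Qed.

Definition beta : nat :=
  #|[arg min_(F < arcs G | feedback_arc_set F) #|F|]|.

Lemma betaP :
  (exists2 F, feedback_arc_set F & #|F| = beta) /\
  (forall F, feedback_arc_set F -> beta <= #|F|).
Proof.
rewrite /beta; case: arg_minnP => [|F hF minF].
  exact: feedback_arc_set_arcs.
by split=> //; exists F.
Qed.

End Dicycles.

Definition le_girth (k : nat) (g : option nat) : bool :=
  if g is Some l then k <= l else true.

Lemma le_girthP (G : digraph) (k : nat) :
  le_girth k (girth G) <-> forall c : seq G, dicycle c -> k <= size c.
Proof.
rewrite /girth; set p := fun l => [exists c : l.-tuple G, dicycle c].
have pP (c : seq G) : dicycle c -> size c \in [seq l <- iota 0 #|G|.+1 | p l].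
  move=> dc; rewrite mem_filter mem_iota /= add0n dicycle_size // andbT.
  by apply/existsP; exists (in_tuple c).
have srt : sorted leq [seq l <- iota 0 #|G|.+1 | p l].
  exact: (sorted_filter leq_trans _ (iota_sorted _ _)).
have memp l : l \in [seq l <- iota 0 #|G|.+1 | p l] -> p l.
  by rewrite mem_filter => /andP[].
case: [seq l <- _ | _] pP srt memp => [|l s] pP srt memp /=.
  by split=> // _ c /pP.
split=> [kl c /pP | h].
  rewrite inE => /predU1P[-> // | ls]; apply: leq_trans kl _.
  by move: srt => /= /(order_path_min leq_trans)/allP; apply.
by have /existsP[c /h] := memp l (mem_head _ _); rewrite size_tuple.
Qed.

(* Main.v *)
Require Import Defs.
From mathcomp Require Import all_boot all_order all_algebra zify lra.

Set Implicit Arguments.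
Unset Strict Implicit.
Unset Printing Implicit Defensive.

Import Order.TTheory GRing.Theory Num.Theory.
Local Open Scope ring_scope.

(** A 3-tree on [n] vertices has [3n - 6] edges, so the bound reads
    [beta <= n - 3].  Build a linear ordering along the 3-tree order, placing
    each new vertex first or last: of its three arcs, one placement makes at
    most one go backwards.  It remains to gain one arc at the start: the fourth
    vertex has two out-neighbours, or two in-neighbours, among the first three;
    ordering it together with these two costs nothing, and adding the last
    vertex of the [K_4] costs at most one arc.

    For tightness take the vertices [0, ..., n - 1] with arcs [i -> i + 1],
    [i -> i + 2] and [i + 3 -> i]: the triangles [i -> i + 1 -> i + 3 -> i] are
    [n - 3] arc-disjoint dicycles. *)

Local Open Scope nat_scope.

(* [path.arc] shadows the arc relation of digraphs. *)
Local Notation arc := Defs.arc.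

(** * Digons and packings of dicycles *)

Lemma le_girth3P (G : digraph) :
  le_girth 3 (girth G) <-> forall x y : G, arc x y -> ~~ arc y x.
Proof.
rewrite le_girthP; split=> [h x y xy | h [|x [|y [|z c]]] //].
  apply/negP => yx; suff /h : dicycle [:: x; y] by [].
  rewrite /dicycle /= xy yx !inE !andbT.
  by apply: contraL xy => /eqP->; rewrite /arc arcs_irrefl.
by case/and3P=> _ _ /= /and3P[/h/negP].
Qed.

(** A feedback arc set meets each [c i]; disjointness makes the chosen arcs distinct. *)
Lemma beta_ge_packing (G : digraph) (k : nat) (c : 'I_k -> seq G) :
  (forall i, dicycle (c i)) ->
  (forall i j, i != j ->
     [disjoint dicycle_arcs (c i) & dicycle_arcs (c j)]) ->
  k <= beta G.
Proof.
move=> dc disj; have [[F /feedback_arc_setP[_ hF] <-] _] := betaP G.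
have {}hF i := set0Pn _ (hF _ (dc i)).
pose f i := xchoose (hF i).
have fP i : f i \in F /\ f i \in dicycle_arcs (c i).
  by apply/andP; rewrite -in_setI (xchooseP (hF i)).
have f_inj : injective f.
  move=> i j eq_f; apply/eqP/negPn/negP => /disj/pred0P/(_ (f i)) /=.
  by rewrite (fP i).2 eq_f (fP j).2.
rewrite -[leqLHS]card_ord -(card_imset predT f_inj); apply: subset_leq_card.
by apply/subsetP => _ /imsetP[i _ ->]; exact: (fP i).1.
Qed.

Lemma cardsU_disjoint (T : finType) (A B : {set T}) :
  [disjoint A & B] -> #|A :|: B| = #|A| + #|B|.
Proof. by rewrite -leq_card_setU => /eqP. Qed.

(** * Vertex rankings and their backward arcs *)

Section BackwardArcs.

Variable G : digraph.
Implicit Types (S : {set G}) (x : G) (r : G -> nat).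

Definition arcs_in S : {set G * G} :=
  [set a in arcs G | (a.1 \in S) && (a.2 \in S)].

(** Ties count as backward, so [r] may be any ranking, injective or not. *)
Definition backward r S : {set G * G} := [set a in arcs_in S | r a.2 <= r a.1].

Definition out_nbrs S x : {set G} := [set y in S | arc x y].
Definition in_nbrs S x : {set G} := [set y in S | arc y x].

Lemma arcs_inT : arcs_in setT = arcs G.
Proof. by apply/setP=> a; rewrite !inE !andbT. Qed.

Lemma arcs_inU1 S x :
  arcs_in (x |: S) =
    arcs_in S :|: ([set (x, y) | y in out_nbrs S x] :|:
                   [set (y, x) | y in in_nbrs S x]).
Proof.
apply/setP=> -[a b]; apply/idP/idP.
  rewrite inE => /= /and3P[ab /setU1P[ax|aS] /setU1P[bx|bS]].
  - by move: ab; rewrite ax bx (negbTE (arcs_irrefl x)).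
  - by rewrite !inE ax imset_f ?orbT // inE bS /arc -ax.
  - by rewrite !inE bx imset_f ?orbT // inE aS /arc -bx.
  - by rewrite !inE ab aS bS.
case/setUP=> [|/setUP[]].
  by rewrite !inE => /= /and3P[-> -> ->]; rewrite !orbT.
  by case/imsetP=> y; rewrite !inE => /andP[yS xy] [-> ->];
    rewrite /= eqxx yS orbT !andbT.
by case/imsetP=> y; rewrite !inE => /andP[yS xy] [-> ->];
    rewrite /= eqxx yS orbT !andbT.
Qed.

Lemma card_arcs_inU1 S x : x \notin S ->
  #|arcs_in (x |: S)| = #|arcs_in S| + (#|out_nbrs S x| + #|in_nbrs S x|).
Proof.
move=> xS; have neqx y : y \in S -> y == x = false.
  by move=> yS; apply: contraNF xS => /eqP<-.
rewrite arcs_inU1 !cardsU_disjoint ?card_imset //; try by move=> y z [].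
  rewrite disjoint_subset; apply/subsetP=> _ /imsetP[y _ ->].
  apply/imsetP=> -[z].
  by rewrite inE => /andP[/neqx zx _] [xz _]; rewrite xz eqxx in zx.
rewrite disjoint_subset; apply/subsetP=> -[a b].
rewrite inE => /and3P[_ /neqx ax /neqx bx]; apply/negP.
by case/setUP=> /imsetP[y _ [ea eb]]; rewrite /= ?ea ?eb eqxx in ax bx.
Qed.

(** Along a dicycle without backward arcs the rank would increase strictly all the way round, back
    to its starting value. *)
Lemma backward_feedback r : feedback_arc_set (backward r setT).
Proof.
apply/feedback_arc_setP; split=> [|c /and3P[sz uc cc]].
  by rewrite -arcs_inT; apply/subsetP=> a; rewrite inE => /andP[].
apply/negP => /eqP/setP c0.
have : cycle (relpre r ltn) c.
  apply: cycle_from_next => // x xc; have := c0 (x, next c x).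
  have xn : (x, next c x) \in arcs G := next_cycle cc xc.
  rewrite !inE /= xn imset_f // andbT => /negbT.
  by rewrite -ltnNge.
rewrite -cycle_map; case: c sz {uc cc c0} => //= x c _.
move=> /(order_path_min ltn_trans)/allP/(_ (r x)).
by rewrite mem_rcons mem_head ltnn => /(_ isT).
Qed.

Definition orderable S k := exists r, #|backward r S| <= k.

Lemma orderable_beta k : orderable setT k -> beta G <= k.
Proof.
case=> r; apply: leq_trans.
by have [_ ->] := betaP G; rewrite ?backward_feedback.
Qed.

Lemma orderable0 : orderable set0 0.
Proof.
exists (fun=> 0); rewrite leqn0 cards_eq0; apply/eqP/setP=> a.
by rewrite !inE /= andbF.
Qed.

Lemma orderableU1 S x k : x \notin S -> orderable S k ->
  orderable (x |: S) (k + minn #|out_nbrs S x| #|in_nbrs S x|).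
Proof.
move=> xS [r rk]; have neqx y : y \in S -> y == x = false.
  by move=> yS; apply: contraNF xS => /eqP<-.
have [_|_] := leqP.
  (* Ranked last, [x] makes backward only its arcs into [S]. *)
  exists (fun y => if y == x then (\max_z r z).+1 else r y).
  apply: leq_trans (leq_add rk (leq_imset_card (pair x) _)).
  apply: leq_trans (leq_card_setU _ _); apply: subset_leq_card.
  apply/subsetP=> -[a b]; rewrite inE arcs_inU1 => /= /andP[].
  case/setUP=> [ab | /setUP[abx _|]]; last 2 first.
  - by rewrite inE abx orbT.
  - case/imsetP=> y; rewrite inE => /andP[/neqx yx _] [-> ->].
    by rewrite eqxx yx ltnNge leq_bigmax.
  move: (ab); rewrite inE => /and3P[_ /neqx/=-> /neqx/=->] rba.
  by rewrite 2!inE ab rba.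
(* Ranked first, below the shifted ranks of [S], [x] makes backward only the arcs from [S] into
   it. *)
exists (fun y => if y == x then 0 else (r y).+1).
apply: leq_trans (leq_add rk (leq_imset_card (pair^~ x) _)).
apply: leq_trans (leq_card_setU _ _); apply: subset_leq_card.
apply/subsetP=> -[a b]; rewrite inE arcs_inU1 => /= /andP[].
case/setUP=> [ab | /setUP[|abx _]]; last 2 first.
- case/imsetP=> y; rewrite inE => /andP[/neqx yx _] [-> ->].
  by rewrite eqxx yx.
- by rewrite inE abx orbT.
move: (ab); rewrite inE => /and3P[_ /neqx/=-> /neqx/=->]; rewrite ltnS => rba.
by rewrite 2!inE ab rba.
Qed.

(** * Cheap placements when no arc is reversed by another *)

Hypothesis arc_asym : forall x y : G, arc x y -> ~~ arc y x.

Lemma out_in_disjoint S x : [disjoint out_nbrs S x & in_nbrs S x].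
Proof.
apply/pred0P=> y; rewrite /= !inE; case xy: (arc x y); last by rewrite andbF.
by rewrite (negbTE (arc_asym xy)) !andbF.
Qed.

Lemma card_nbrs S x :
  #|@nbrs_in (underlying G) S x| = #|out_nbrs S x| + #|in_nbrs S x|.
Proof.
rewrite -cardsU_disjoint ?out_in_disjoint //; apply: eq_card => y.
by rewrite !inE -andb_orr.
Qed.

Lemma card_nbrs_le S x : #|@nbrs_in (underlying G) S x| <= #|S|.
Proof. by apply/subset_leq_card/subsetP=> y; rewrite inE => /andP[]. Qed.

(** By asymmetry the out- and in-neighbours of [x] partition its neighbours, so the smaller class
    has at most [d./2] elements. *)
Lemma orderableU1_half S x k d : x \notin S ->
  #|@nbrs_in (underlying G) S x| <= d -> orderable S k ->
  orderable (x |: S) (k + d./2).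
Proof.
move=> xS; rewrite card_nbrs => led /(orderableU1 xS)[r rk]; exists r.
by apply: leq_trans rk _; lia.
Qed.

Lemma orderable2 a b : a != b -> orderable [set a; b] 0.
Proof.
move=> ab; apply: (@orderableU1_half _ _ 0 1); first by rewrite inE.
  by rewrite -(cards1 b) card_nbrs_le.
rewrite -(setU0 [set b]).
apply: (@orderableU1_half _ _ 0 0) orderable0; rewrite ?inE //.
by rewrite -(cards0 G) card_nbrs_le.
Qed.

(** Adding the vertices in the given order could cost 0 + 0 + 1 + 1; bringing [x] in before one
    vertex of [S] saves one arc. *)
Lemma orderable_K4 S x : x \notin S -> #|S| = 3 ->
  #|@nbrs_in (underlying G) S x| = 3 -> orderable (x |: S) 1.
Proof.
move=> xS S3; rewrite card_nbrs => deg3.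
(* [A] is the out- or the in-neighbourhood of [x], whichever has two elements; all arcs between [x]
   and [A] have the same direction. *)
have [A [AS A2 minA]] : exists A : {set G}, [/\ A \subset S, 1 < #|A| &
    forall B : {set G}, B \subset A -> minn #|out_nbrs B x| #|in_nbrs B x| = 0].
  have no_nbr (e f : rel G) (B : {set G}) : (forall y, e x y -> ~~ f x y) ->
      B \subset [set y in S | e x y] -> #|[set y in B | f x y]| = 0.
    move=> ef /subsetP BA; apply: eq_card0 => y; rewrite !inE.
    by apply/andP=> -[/BA]; rewrite inE => /andP[_ /ef/negP].
  have [|] := ltnP 1 #|out_nbrs S x| => [out2 | out1].
    exists (out_nbrs S x); split=> // [|B BA].
      by apply/subsetP=> y; rewrite inE => /andP[].
    rewrite (no_nbr _ (fun x y => arc y x) B _ BA) ?minn0 // => y.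
    exact: arc_asym.
  exists (in_nbrs S x); split=> [||B BA]; last 1 first.
  - rewrite [#|out_nbrs B x|](no_nbr (fun x y => arc y x) _ B _ BA) ?min0n //.
    move=> y.
    exact: arc_asym.
  - by apply/subsetP=> y; rewrite inE => /andP[].
  - by lia.
have /card_gt1P[a [b [aA bA ab]]] := A2.
set T := [set a; b].
have TA : T \subset A by rewrite subUset !sub1set aA.
have T2 : #|T| = 2 by rewrite cards2 ab.
have [z zST] : exists z, S :\: T = [set z].
  apply/cards1P; rewrite cardsD (setIidPr _) ?S3 ?T2 //.
  exact: subset_trans AS.
have /andP[zT zS] : (z \notin T) && (z \in S).
  by rewrite -in_setD zST inE.
have defS : z |: T = S.
  rewrite setUC -zST setDE setUIr setUCr setIT.
  by apply/setUidPr; exact: subset_trans AS.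
have TS : T \subset S := subset_trans TA AS.
have xT : x \notin T := contraNN (subsetP TS x) xS.
have zx : z != x by apply: contraNneq xS => <-.
have ord_xT : orderable (x |: T) 0.
  rewrite -[0](addn0 0) -{2}(minA T TA); apply: orderableU1 => //.
  exact: orderable2.
(* The vertex [z] left over from [S] comes last in the construction: it has at most three
   neighbours, and [3./2] is 1. *)
rewrite -defS setUCA -[1]/(0 + 3./2); apply: orderableU1_half => //.
  by rewrite in_setU1 negb_or zx.
by apply: leq_trans (card_nbrs_le _ _) _; rewrite cardsU1 xT T2.
Qed.

(** * Induction along a k-tree order *)

Definition initial n (v : 'I_n -> G) i : {set G} :=
  [set v j | j : 'I_n & j < i].

Lemma initial0 n (v : 'I_n -> G) : initial v 0 = set0.
Proof. by apply/setP=> x; rewrite inE; apply/imsetP=> -[j]; rewrite inE. Qed.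

(** Puts the order in the form used by the inductions: prefixes grow by one vertex, whose number of
    earlier neighbours is known. *)
Lemma ktree_initial k : ktree (underlying G) k ->
  k < #|G| /\ exists v : 'I_#|G| -> G,
    [/\ initial v #|G| = setT,
        forall i : 'I_#|G|, initial v i.+1 = v i |: initial v i,
        forall i : 'I_#|G|, v i \notin initial v i &
        forall i : 'I_#|G|,
          #|@nbrs_in (underlying G) (initial v i) (v i)| = minn k i].
Proof.
case=> kn [v v_inj hv]; split=> //; exists v.
have initialS (i : 'I_#|G|) : initial v i.+1 = v i |: initial v i.
  apply/setP=> x; rewrite inE; apply/imsetP/orP=> [[j] | [/set1P->|/imsetP[j]]].
  - rewrite inE ltnS leq_eqVlt => /orP[/eqP/val_inj-> ->|ji ->].
      by left; rewrite inE.
    by right; apply: imset_f; rewrite inE.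
  - by exists i; rewrite ?inE.
  - by rewrite inE => ji ->; exists j; rewrite // inE ltnW.
split=> // [|i|i].
- apply/setP=> x; rewrite inE.
  have /codomP[i ->] : x \in codom v by apply: inj_card_onto; rewrite ?card_ord.
  by apply: imset_f; rewrite inE.
- by apply/imsetP=> -[j ji /v_inj ij]; rewrite inE -ij ltnn in ji.
(* The prefix in [ktree] contains [v i] itself, which is not its own neighbour, so dropping it
   leaves the count unchanged. *)
have [_ <-] := hv i; apply: eq_card => y; rewrite !inE.
rewrite -[[set v j | j : 'I__ & _ <= _]]/(initial v i.+1) initialS in_setU1.
by case: eqP => //= ->; rewrite uadj_irrefl !andbF.
Qed.

(** By asymmetry each underlying edge carries exactly one arc, so a new vertex brings as many arcs
    as earlier neighbours. *)
Lemma ktree_card_arcs k : ktree (underlying G) k ->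
  num_arcs G = \sum_(i < #|G|) minn k i.
Proof.
case/ktree_initial=> _ [v [initialT initialS vN deg]].
suff H i : i <= #|G| -> #|arcs_in (initial v i)| = \sum_(j < i) minn k j.
  by rewrite -H // initialT arcs_inT.
elim: i => [_|i IH lt_i].
  by rewrite initial0 big_ord0; apply: eq_card0 => a; rewrite !inE /= andbF.
rewrite big_ord_recr /= -(IH (ltnW lt_i)) (initialS (Ordinal lt_i)).
by rewrite card_arcs_inU1 // -card_nbrs deg.
Qed.

Lemma ktree3_orderable : ktree (underlying G) 3 -> orderable setT (#|G| - 3).
Proof.
case/ktree_initial=> n4 [v [initialT initialS vN deg]].
have card_initial i : i <= #|G| -> #|initial v i| = i.
  elim: i => [_|i IH lt_i]; first by rewrite initial0 cards0.
  by rewrite (initialS (Ordinal lt_i)) cardsU1 vN /= (IH (ltnW lt_i)).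
(* The base case is the first [K_4], at cost 1; every later vertex adds [3./2], that is 1. *)
suff H i : i.+4 <= #|G| -> orderable (initial v i.+4) i.+1.
  have [m cardG] : exists m, #|G| = m.+4 by exists (#|G| - 4); lia.
  by have := H m; rewrite -cardG initialT cardG !subSS subn0; apply.
elim: i => [_|i IH lt_i].
  rewrite (initialS (Ordinal n4)); apply: orderable_K4; rewrite ?vN ?deg //.
  by rewrite card_initial // ltnW.
rewrite -[X in orderable _ X]addn1 (initialS (Ordinal lt_i)).
apply: (@orderableU1_half _ _ _ 3); rewrite ?vN ?deg ?geq_minl //.
exact/IH/ltnW.
Qed.

End BackwardArcs.

Lemma sum_minn3 n : 2 < n -> \sum_(i < n) minn 3 i + 6 = 3 * n.
Proof.
elim: n => // n IH; rewrite ltnS leq_eqVlt => /predU1P[<- | n3].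
  by rewrite !big_ord_recr big_ord0.
by rewrite big_ord_recr /= addnAC IH // (minn_idPl n3) mulnS addnC.
Qed.

Lemma ktree3_bounds (G : digraph) :
  ktree (underlying G) 3 -> le_girth 3 (girth G) ->
  num_arcs G + 6 = 3 * #|G| /\ beta G + 3 <= #|G|.
Proof.
move=> kG /le_girth3P asymG; have n4 : 3 < #|G| by case: kG.
rewrite (ktree_card_arcs asymG kG) sum_minn3 ?(ltnW n4) //; split=> //.
rewrite addnC -leq_subRL ?(ltnW n4) //.
exact: orderable_beta (ktree3_orderable asymG kG).
Qed.

(** * The tight examples *)

Section ThreeTreePath.
Variable n : nat.

(** An orientation of the cube of a path: steps of 1 and 2 go up, steps of 3 go down. *)
Definition path_arcs : {set 'I_n * 'I_n} :=
  [set a : 'I_n * 'I_n | [|| a.2 == a.1.+1 :> nat, a.2 == a.1.+2 :> nat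
             | a.1 == a.2.+3 :> nat]].

Lemma path_arcs_irrefl x : (x, x) \notin path_arcs.
Proof. by rewrite inE /=; lia. Qed.

Definition path_digraph := Digraph path_arcs_irrefl.

Lemma path_digraph_asym (x y : path_digraph) : arc x y -> ~~ arc y x.
Proof. by rewrite /arc !inE /=; lia. Qed.

Lemma path_digraph_uadj (x y : 'I_n) :
  @uadj path_digraph x y = [&& x != y :> nat, x <= y + 3 & y <= x + 3].
Proof. by rewrite /uadj /arc !inE /=; lia. Qed.

(** In the natural order the earlier neighbours of a vertex are its at most three immediate
    predecessors, which differ pairwise by at most 2. *)
Lemma path_digraph_ktree : 3 < n -> ktree (underlying path_digraph) 3.
Proof.
move=> n4; have cardG : #|underlying path_digraph| = n by rewrite card_ord.
split; first by rewrite cardG.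
exists (cast_ord cardG); first exact: cast_ord_inj.
move=> i; set N := nbrs_in _ _.
have inN y : (y \in N) = (y < i <= y + 3).
  rewrite inE /= path_digraph_uadj /=.
  suff -> : (y \in [set cast_ord cardG j | j : 'I__ & j <= i]) = (y <= i).
    by move: (nat_of_ord i) (nat_of_ord y) => a b; lia.
  apply/imsetP/idP=> [[j] | yi]; first by rewrite inE => ji ->.
  by exists (cast_ord (esym cardG) y); rewrite ?inE ?cast_ordKV.
clearbody N; move: (nat_of_ord i) (ltn_ord i) inN => {i} m.
rewrite cardG => m_lt inN; split=> [x y | ].
  rewrite !inN -(inj_eq val_inj) [adj _ _]path_digraph_uadj /=.
  by move: (nat_of_ord x) (nat_of_ord y) => a b; lia.
(* [f] lists the predecessors [m - 1], [m - 2], [m - 3]; the bound [j < m] keeps the subtraction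
   from truncating. *)
have f_lt (j : 'I_(minn 3 m)) : m - j.+1 < n by lia.
pose f j : path_digraph := Ordinal (f_lt j).
have f_inj : injective f.
  move=> j k /(congr1 val) /= jk; apply: val_inj => /=.
  by have := ltn_ord j; have := ltn_ord k; lia.
rewrite -[RHS]card_ord -(card_imset predT f_inj); apply: eq_card => y.
rewrite inN; apply/idP/imsetP=> [yi | [j _ ->]].
  have jlt : m - y.+1 < minn 3 m by lia.
  by exists (Ordinal jlt) => //; apply: val_inj => /=; lia.
by rewrite /=; have := ltn_ord j; lia.
Qed.

Lemma path_digraph_beta : 3 < n -> n - 3 <= beta path_digraph.
Proof.
move=> n4; have bound (i : 'I_(n - 3)) d : d <= 3 -> i + d < n.
  by have := ltn_ord i; lia.
pose u i d (le_d : d <= 3) : path_digraph := Ordinal (bound i d le_d).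
pose c i := [:: u i 0 isT; u i 1 isT; u i 3 isT].
(* The three arcs of a triangle have differences +1, +2 and -3, so an arc determines its kind, and
   with it [i]. *)
have arc_c i (x y : 'I_n) : (x, y) \in dicycle_arcs (c i) ->
    x = i :> nat /\ y = i + 1 :> nat \/ x = i + 1 :> nat /\ y = i + 3 :> nat
      \/ x = i + 3 :> nat /\ y = i :> nat.
  case/imsetP=> z; rewrite !inE => /or3P[]/eqP-> [-> ->] /=;
    by rewrite -!(inj_eq (@ord_inj n)) /=; do 3? [case: eqP => /= ?]; lia.
apply: (@beta_ge_packing _ _ c) => [i | i j ij].
  by rewrite /dicycle /= /arc !inE -!(inj_eq (@ord_inj n)) /=; lia.
rewrite disjoint_subset; apply/subsetP=> -[x y] /arc_c xyi.
apply/negP=> /arc_c xyj.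
by case/eqP: ij; apply: val_inj => /=; lia.
Qed.

End ThreeTreePath.

Local Open Scope ring_scope.

Theorem theorem4 :
  (forall G : digraph,
     ktree (underlying G) 3 ->
     le_girth 3 (girth G) ->
     (beta G)%:R <= ((num_arcs G)%:R - 3) / 3 :> rat)
  /\
  (forall N : nat, exists G : digraph,
     [/\ (N <= #|G|)%N,
         ktree (underlying G) 3,
         le_girth 3 (girth G) &
         (beta G)%:R = ((num_arcs G)%:R - 3) / 3 :> rat]).
Proof.
split=> [G kG gG | N].
  have [m b] := ktree3_bounds kG gG.
  (* Clearing the denominator leaves an inequality in [nat], which follows from [m = 3n - 6] and
     [beta + 3 <= n]. *)
  suff : (3 * (beta G) + 3)%:R <= (num_arcs G)%:R :> rat.
    by rewrite natrD natrM; lra.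
  by rewrite ler_nat; lia.
pose G := path_digraph N.+4.
have kG : ktree (underlying G) 3 by exact: path_digraph_ktree.
have gG : le_girth 3 (girth G) by apply/le_girth3P; exact: path_digraph_asym.
exists G; split=> //; first by rewrite card_ord; lia.
have := path_digraph_beta (isT : 3 < N.+4)%N; have [] := ktree3_bounds kG gG.
rewrite card_ord -/G => m b b'.
(* The packing bound and the upper bound together force [beta = n - 3]. *)
suff /(congr1 (fun i => i%:R : rat)) : (num_arcs G = 3 * beta G + 3)%N.
  by rewrite natrD natrM => ->; lra.
lia.
Qed.
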